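(* Let $S=k[x_{1,0},\ldots,x_{1,n_1},\ldots,x_{m,0},\ldots,x_{m,n_m}]$ and for $i=1,\ldots,m$ let $S^{[i]}=k[x_{i,0},\ldots,x_{i,n_i}]$ with $n_i\ge1$, and $T^{[i]}=k[X_{i,0},\ldots,X_{i,n_i}]$. Let $F = F_1+ \cdots + F_m \in S_d$ with $F_i \in S^{[i]}_d$. Let $e\ge1$ be an integer. If every $F_i$, regarded as a form in $S^{[i]}$, is $e$-computable and satisfies $(F_i^\perp)_e=0$ (with $F_i^\perp\subseteq T^{[i]}$), then \[ \mathrm{rk}(F) = \mathrm{rk} (F_1 )+ \cdots + \mathrm{rk} (F_m ).\]
   Context: $k$ is algebraically closed of characteristic zero. $T^{[i]}$ acts on $S^{[i]}$ by differentiation ($X_{i,j}\circ G=\partial G/\partial x_{i,j}$); $F_i^\perp=\{g\in T^{[i]}: g\circ F_i=0\}$. $HF(R/J,j)=\dim_kR_j-\dim_kJ_j$. The rank $\mathrm{rk}(G)$ of a form $G$ of degree $d$ is the least $r$ with $G=\sum_{j=1}^rL_j^d$, $L_j$ linear forms (this does not depend on the polynomial ring in which $G$ is considered). A form $G\in S^{[i]}$ is $e$-computable if there is a homogeneous ideal $I\subset T^{[i]}$ generated in degree $e$ such that for a general $t\in I_e$ (i.e. $t$ in a nonempty Zariski-open subset of $I_e$) $\mathrm{rk}(G)=\frac1e\sum_{j=0}^\infty HF(T^{[i]}/((G^\perp:I)+(t)),j)$. *)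

(* Defs.v *)
From HB Require Import structures.
From mathcomp Require Import all_boot all_order all_algebra.
From mathcomp Require Import mpoly.
From Stdlib Require Import ClassicalEpsilon.
Set Implicit Arguments. Unset Strict Implicit. Unset Printing Implicit Defensive.
Import Order.TTheory GRing.Theory.
Local Open Scope ring_scope.

Definition pbool (P : Prop) : bool :=
  if excluded_middle_informative P then true else false.

Definition cmin (P : nat -> Prop) : nat :=
  match excluded_middle_informative (exists r, pbool (P r)) with
  | left h => ex_minn h
  | right _ => 0%N
  end.

Section Defs.
Variables (k : fieldType) (N : nat).
Notation poly := {mpoly k[N]}.

Definition waring_decomp (d : nat) (G : poly) (r : nat) : Prop :=
  exists L : 'I_r -> poly,
    (forall j, L j \is 1.-homog) /\ G = \sum_(j < r) (L j) ^+ d.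

Definition rk (d : nat) (G : poly) : nat := cmin (waring_decomp d G).

(* contraction/differentiation action of T = k[X_0..X_{N-1}] on S = k[x_0..x_{N-1}]:
   the monomial X^a acts as the differential operator d^a/dx^a *)
Definition contract (g G : poly) : poly :=
  \sum_(a <- msupp g) g@_a *: mderivm a G.

Definition perp (G : poly) : pred poly := fun g => contract g G == 0.

Definition ideal_gen (gs : seq poly) (p : poly) : Prop :=
  exists h : 'I_(size gs) -> poly, p = \sum_(j < size gs) h j * gs`_j.

Definition colon (J I : poly -> Prop) (g : poly) : Prop :=
  forall h, I h -> J (g * h).

Definition add_principal (J : poly -> Prop) (t : poly) (p : poly) : Prop :=
  exists a b, J a /\ p = a + b * t.

Definition lin_indep r (b : 'I_r -> poly) : Prop :=
  forall c : 'I_r -> k, \sum_(j < r) c j *: b j = 0 -> forall j, c j = 0.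

Definition has_basis (P : poly -> Prop) (r : nat) : Prop :=
  exists b : 'I_r -> poly,
    [/\ forall j, P (b j), lin_indep b &
        forall v, P v -> exists c : 'I_r -> k, v = \sum_(j < r) c j *: b j].

Definition dimsp (P : poly -> Prop) : nat := cmin (has_basis P).

Definition comp (J : poly -> Prop) (j : nat) (p : poly) : Prop :=
  J p /\ p \is j.-homog.

Definition HF (J : poly -> Prop) (j : nat) : nat :=
  (dimsp (comp (fun _ => True) j) - dimsp (comp J j))%N.

(* sum_{j >= 0} HF(T/J, j) = s  (the sum of nonnegative integers is finite
   and equal to s) *)
Definition HF_total_is (J : poly -> Prop) (s : nat) : Prop :=
  exists j0 : nat, (forall j, (j0 <= j)%N -> HF J j = 0%N) /\
                   (\sum_(j < j0) HF J j)%N = s.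

(* G (a form of degree d) is e-computable: there is a homogeneous ideal
   I = (gs) generated by forms gs of degree e such that for a general
   t in I_e = span(gs) -- i.e. for t = sum_j c_j gs_j with c in a nonempty
   Zariski-open subset { c | p(c) <> 0 }, p <> 0, of the coefficient space --
   one has e * rk(G) = sum_j HF(T/((G^perp : I) + (t)), j). *)
Definition e_computable (d e : nat) (G : poly) : Prop :=
  exists gs : seq poly,
    (forall g, g \in gs -> g \is e.-homog) /\
    exists p : {mpoly k[size gs]}, p != 0 /\
      forall c : 'I_(size gs) -> k, p.@[c] != 0 ->
        let t := \sum_(j < size gs) c j *: gs`_j in
        HF_total_is (add_principal (colon (fun g => perp G g) (ideal_gen gs)) t)
                    (e * rk d G)%N.

End Defs.

(* variables of S: x_{i,j}, i < m, j <= n i, indexed via the finite type of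
   pairs {i : 'I_m & 'I_(n i).+1} *)
Definition blockvar (m : nat) (n : 'I_m -> nat) := {i : 'I_m & 'I_(n i).+1}.
Definition Nvars (m : nat) (n : 'I_m -> nat) : nat := #|{: blockvar n}|.

Definition emb (k : fieldType) (m : nat) (n : 'I_m -> nat) (i : 'I_m)
  (p : {mpoly k[(n i).+1]}) : {mpoly k[Nvars n]} :=
  p \mPo [tuple 'X_(enum_rank (Tagged (fun l => 'I_(n l).+1) j)) | j < (n i).+1].

(* Main.v *)
(** Let [F = sum_a L_a^d] with [r = rk F] terms, view the [L_a] as points, let
    [I_i], [t_i] witness the [e]-computability of [F_i], put [T = sum_i t_i] and
    let [A] be the set of points at which some [I_i] does not vanish; for general
    [t_i], the form [T] has no zero on [A].  Let [V_j] be the space of value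
    vectors on [A] of the forms of degree [j].  If [sum_i c_i] and [T h] have the
    same values on [A], then multiplying their difference by [g] in [I_i] gives a
    form vanishing at every [L_a], hence killing [F], and restricting to block
    [i] shows that [c_i] lies in [(F_i^perp : I_i) + (t_i)].  So with [N_j] the
    sum over [i] of the Hilbert functions of [T_i/((F_i^perp : I_i) + (t_i))] in
    degree [j], [N_(j+e) + dim V_j <= dim V_(j+e)].  Since [(F_i^perp)_e = 0],
    the direct sum of the [(T_i)_e] injects into the values on all [r] points,
    which yields [N_0 + N_e <= dim V_e + (r - |A|)].  Telescoping in each residue
    class modulo [e] gives [e sum_i rk F_i = sum_j N_j <= e r]. *)

Require Import Defs.
From HB Require Import structures.
From mathcomp Require Import all_boot all_order all_algebra.
From mathcomp Require Import mpoly.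
From mathcomp Require Import ssrcomplements.
From Stdlib Require Import Classical ClassicalEpsilon.
Set Implicit Arguments. Unset Strict Implicit. Unset Printing Implicit Defensive.
Import GRing.Theory.
Local Open Scope ring_scope.

(** * Linear algebra *)

Lemma pboolP (P : Prop) : reflect P (pbool P).
Proof.
by rewrite /pbool; case: excluded_middle_informative => H; constructor.
Qed.

Lemma cmin_eq (P : nat -> Prop) r :
  P r -> (forall s, P s -> (r <= s)%N) -> cmin P = r.
Proof.
move=> Pr r_min; rewrite /cmin; case: excluded_middle_informative => [h|[]].
  case: ex_minnP => s /pboolP/r_min le_rs s_min; apply/eqP.
  by rewrite eqn_leq le_rs andbT; apply/s_min/pboolP.
by exists r; apply/pboolP.
Qed.

Lemma cminP (P : nat -> Prop) r : P r -> P (cmin P) /\ (cmin P <= r)%N.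
Proof.
move=> Pr; rewrite /cmin; case: excluded_middle_informative => [h|[]].
  by case: ex_minnP => s /pboolP Ps s_min; split=> //; apply/s_min/pboolP.
by exists r; apply/pboolP.
Qed.

Section LinearAlgebra.
Variable k : fieldType.

(** Start from the zero subspace and, as long as some vector of [P] lies outside, adjoin its line;
    the induction is on a bound for the codimension. *)
Lemma vspace_of_pred (V : vectType k) (P : V -> Prop) :
    P 0 -> (forall a u v, P u -> P v -> P (a *: u + v)) ->
  exists U : {vspace V}, forall v, P v <-> v \in U.
Proof.
move=> P0 Plin.
suff grow n (U : {vspace V}) : (dim V - \dim U <= n)%N ->
    (forall v, v \in U -> P v) -> exists U : {vspace V}, forall v, P v <-> v \in U.
  by apply: (grow _ 0%VS (leqnn _)) => v; rewrite memv0 => /eqP->.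
elim: n U => [|n IHn] U le_n UP.
  exists U => v; split=> [_|/UP//]; suff ->: U = fullv by rewrite memvf.
  apply/eqP; rewrite -(dimv_leqif_eq (subvf U)) eqn_leq dimvS ?subvf //=.
  by rewrite dimvf -subn_eq0 -leqn0.
case: (classic (forall v, P v -> v \in U)) => [PU|]; first by exists U; split; auto.
move=> /not_all_ex_not[v /(@imply_to_and (P v))[Pv /negP U'v]].
apply: (IHn (<[v]> + U)%VS) => [|w /memv_addP[_ /vlineP[a ->] [u /UP Pu ->]]].
  rewrite dimv_disjoint_sum ?dim_vline; last first.
    apply/eqP; rewrite -subv0; apply/subvP => w; rewrite memv_cap => /andP[].
    case/vlineP=> a -> Uav; case: (eqVneq a 0) => [->|a0]; first by rewrite scale0r mem0v.
    by case/negP: U'v; rewrite -[v](scalerK a0) memvZ.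
  rewrite (_ : v != 0) ?add1n ?subnS; first by case: (_ - _)%N le_n.
  by apply: contraNneq U'v => ->; rewrite mem0v.
exact: Plin.
Qed.

(** Complements of the [K i] map injectively under [f i], and the hypothesis makes their images
    independent of each other and of [W], so dimensions add up inside [D]. *)
Lemma sum_codim_leq (I : finType) (U : I -> vectType k) (V : vectType k)
    (f : forall i, {linear U i -> V}) (K : forall i, {vspace U i})
    (W D : {vspace V}) :
    (forall i u, f i u \in D) -> (W <= D)%VS ->
    (forall u : forall i, U i, \sum_i f i (u i) \in W -> forall i, u i \in K i) ->
  (\sum_i (dim (U i) - \dim (K i)) + \dim W <= \dim D)%N.
Proof.
move=> fD WD fW.
pose C i := (linfun (f i) @: (K i)^C)%VS.
have Cf (w : I -> V) : (forall i, w i \in C i) -> exists2 u : forall i, U i,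
    forall i, u i \in (K i)^C%VS & forall i, w i = f i (u i).
  move=> wC; have ex i : exists u, (u \in (K i)^C%VS) && (w i == f i u).
    by have /memv_imgP[u ? ->] := wC i; exists u; rewrite lfunE eqxx andbT.
  by exists (fun i => xchoose (ex i)) => i; have /andP[? /eqP] := xchooseP (ex i).
have CK0 i u : u \in K i -> u \in (K i)^C%VS -> u = 0.
  by move=> Ku K'u; apply/eqP; rewrite -memv0 -(capv_compl (K i)) memv_cap Ku.
have dimC i : \dim (C i) = (dim (U i) - \dim (K i))%N.
  rewrite -dimvf -dimv_compl; apply: limg_dim_eq; apply/eqP; rewrite -subv0.
  apply/subvP => u /[!memv_cap] /andP[K'u]; rewrite memv_ker lfunE memv0 => /eqP fu.
  apply/eqP/(CK0 i) => //.
  (* The family with value [u] at [i] and 0 elsewhere; the equality proof transports [u] to the type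
     [U j]. *)
  pose us j : U j := if i =P j is ReflectT e then ecast j (U j) e u else 0.
  have usi : us i = u by rewrite /us; case: eqP => // e; rewrite eq_axiomK.
  rewrite -usi; apply: fW; rewrite big1 ?mem0v // => j _; rewrite /us.
  by case: eqP => [e|]; [case: j / e; rewrite fu | rewrite linear0].
rewrite -(eq_bigr _ (fun i _ => dimC i)).
have dirC : directv (\sum_i C i).
  apply/directv_sum_independent => w wC w0 i _.
  have [|u K'u wu] := Cf w; first by move=> j; exact: wC.
  rewrite wu (CK0 i (u i)) ?linear0 //; apply: fW.
  by rewrite -(eq_bigr _ (fun i _ => wu i)) w0 mem0v.
rewrite -(directvP dirC) -dimv_disjoint_sum; last first.
  apply/eqP; rewrite -subv0; apply/subvP => v; rewrite memv_cap => /andP[].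
  case/memv_sumP=> w wC -> Wv; have [|u K'u wu] := Cf w; first by move=> j; exact: wC.
  rewrite big1 ?mem0v // => i _; rewrite wu (CK0 i (u i)) ?linear0 //; apply: fW.
  by rewrite -(eq_bigr _ (fun i _ => wu i)).
apply: dimvS; rewrite subv_add WD andbT; apply/subv_sumP => i _.
by apply/subvP => _ /memv_imgP[u _ ->]; rewrite lfunE; apply: fD.
Qed.

(** Bridge from [dimsp] to [\dim]: [vbasis] attains the minimum, and any competing basis has [U] in
    its span, so it is at least as long. *)
Lemma dimsp_vspace n j (P : {mpoly k[n.+1]} -> Prop) (U : {vspace dhomog n.+1 k j}) :
  (forall u : dhomog n.+1 k j, P (val u) <-> u \in U) -> dimsp (Defs.comp P j) = \dim U.
Proof.
move=> PU; apply: cmin_eq => [|r [b [Pb b_free b_span]]].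
  exists (fun i => val (vbasis U)`_i); split.
  - move=> i; split; last exact: dhomog_is_dhomog.
    by apply/PU/vbasis_mem/mem_nth; rewrite size_tuple.
  - move=> c c0; apply/freeP => //; first exact: (basis_free (vbasisP U)).
    by apply: val_inj; rewrite -[RHS]c0 raddf_sum.
  - move=> v [Pv vj]; pose u : dhomog n.+1 k j := DHomog vj.
    have Uu : u \in U by apply/PU.
    exists (fun i => coord (vbasis U) i u).
    by rewrite -[LHS]/(val u) {1}(coord_vbasis Uu) raddf_sum.
pose B := [tuple (DHomog (proj2 (Pb i)) : dhomog n.+1 k j) | i < r].
have: (U <= <<B>>)%VS.
  apply/subvP => u /PU Pu.
  have [|c uc] := b_span (val u); first by split=> //; exact: dhomog_is_dhomog.
  suff -> : u = \sum_i c i *: tnth B i.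
    by apply: rpred_sum => i _; rewrite rpredZ ?memv_span ?mem_tnth.
  apply: val_inj; rewrite /= uc raddf_sum; apply: eq_bigr => i _.
  by rewrite tnth_mktuple.
move=> /dimvS/leq_trans; apply; apply: leq_trans (dim_span _) _.
by rewrite size_tuple.
Qed.

End LinearAlgebra.

(** * Contraction of powers of linear forms *)

Section Contract.
Variables (k : fieldType) (n : nat).
Implicit Types (u v G L : {mpoly k[n]}).

(** The index set no longer depends on [u], so sums for several [u] can be added termwise. *)
Lemma contractwE (s : nat) u G : (msize u <= s)%N ->
  contract u G = \sum_(m : 'X_{1..n < s}) u@_m *: mderivm m G.
Proof.
pose I : subFinType _ := 'X_{1..n < s}.
move=> le_us; rewrite /contract (big_mksub I) /=; first last.
- by move=> x /msize_mdeg_lt/leq_trans/(_ le_us).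
- by rewrite msupp_uniq.
rewrite big_rmcond //= => i.
by rewrite mcoeff_msupp negbK => /eqP->; rewrite scale0r.
Qed.

Lemma contract_is_linear u : linear (contract u).
Proof.
move=> a G H; rewrite /contract scaler_sumr -big_split /=.
apply: eq_bigr => m _; rewrite linearP scalerDr !scalerA.
by congr (_ *: _ + _); rewrite mulrC.
Qed.
HB.instance Definition _ u :=
  GRing.isLinear.Build k {mpoly k[n]} {mpoly k[n]} _ (contract u) (contract_is_linear u).

Lemma contractDl a u v G : contract (a *: u + v) G = a *: contract u G + contract v G.
Proof.
pose s := maxn (msize (a *: u + v)) (maxn (msize u) (msize v)).
rewrite !(@contractwE s) ?leq_max ?leqnn ?orbT // scaler_sumr -big_split /=.
by apply: eq_bigr => m _; rewrite mcoeffD mcoeffZ scalerDl scalerA.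
Qed.

Lemma contract0l G : contract 0 G = 0.
Proof. by rewrite /contract msupp0 big_nil. Qed.

Lemma contractZl a u G : contract (a *: u) G = a *: contract u G.
Proof. by rewrite -[a *: u]addr0 contractDl contract0l addr0. Qed.

Definition contractl G u := contract u G.

Lemma contractl_is_linear G : linear (contractl G).
Proof. by move=> a u v; exact: contractDl. Qed.
HB.instance Definition _ G :=
  GRing.isLinear.Build k {mpoly k[n]} {mpoly k[n]} _ (contractl G) (contractl_is_linear G).

Lemma contractE G u : contract u G = contractl G u. Proof. by []. Qed.

Lemma contractX m G : contract 'X_[m] G = mderivm m G.
Proof. by rewrite /contract msuppX big_seq1 mcoeffX eqxx scale1r. Qed.

Lemma contractM u v G : contract (u * v) G = contract u (contract v G).
Proof.
rewrite -[LHS]/(contractl G (u * v)) -[RHS]/(contractl (contract v G) u).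
rewrite [in LHS](mpolyE u) [in RHS](mpolyE u) mulr_suml !linear_sum /=.
apply: eq_bigr => a _; rewrite -scalerAl !linearZ /=; congr (_ *: _).
rewrite [RHS]contractX -[contract v G]/(contractl G v).
rewrite [in LHS](mpolyE v) [in RHS](mpolyE v) mulr_sumr
  !(linear_sum (contractl G)) (linear_sum (mderivm a)) /=.
apply: eq_bigr => b _; rewrite -scalerAr !linearZ /=; congr (_ *: _).
by rewrite /contractl -mpolyXD !contractX addmC mderivmDm.
Qed.

(** The point dual to [L]: contracting powers of [L] amounts to evaluating at this point. *)
Definition linpt L : 'I_n -> k := fun i => L@_(U_(i)).

Lemma mderiv_linear L i : L \is 1.-homog -> mderiv i L = (linpt L i)%:MP.
Proof.
move=> L1; apply/mpolyP => m; rewrite mcoeff_mderiv mcoeffC.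
case: eqP => [->|m0]; first by rewrite mnm0E add0m mulr1.
rewrite (dhomog_nemf_coeff L1) ?mul0rn ?mulr0 //.
by rewrite /= mdegD mdeg1 addn1 eqSS mdeg_eq0; apply/eqP.
Qed.

Lemma mderiv_linear_exp L i d : L \is 1.-homog ->
  mderiv i (L ^+ d) = (d%:R * linpt L i) *: L ^+ d.-1.
Proof.
move=> L1; case: d => [|d]; first by rewrite expr0 mul0r scale0r -mpolyC1 mderivC.
elim: d => [|d IHd]; first by rewrite expr1 mul1r mderiv_linear // expr0 -mul_mpolyC mulr1.
rewrite exprS mderivM IHd mderiv_linear // /= -scalerAr -exprS mul_mpolyC -scalerDl.
by rewrite -[d.+2]addn1 natrD mulrDl mul1r addrC.
Qed.

(** Induction on [mdeg m], peeling off one variable. If [mdeg m > d] the falling factorial vanishes,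
    so the truncated exponent is harmless. *)
Lemma mderivm_linear_exp L m d : L \is 1.-homog ->
  mderivm m (L ^+ d) =
    ((d ^_ (mdeg m))%:R * \prod_i linpt L i ^+ m i) *: L ^+ (d - mdeg m).
Proof.
move=> L1; have [s] := ubnP (mdeg m); elim: s m => // s IHs m.
case: (eqVneq m 0%MM) => [->|m0 lt_ms].
  rewrite mdeg0 ffactn0 mul1r subn0 mderivm0m big1 ?scale1r // => i _.
  by rewrite mnm0E.
have [i mi] : exists i, m i != 0%N.
  apply: NNPP => /not_ex_all_not mi0; case/eqP: m0; apply/mnmP => i.
  by rewrite mnm0E; apply/eqP/negPn/negP/mi0.
have mE : m = (m - U_(i) + U_(i))%MM.
  by rewrite submK // lep1mP.
have dm : mdeg m = (mdeg (m - U_(i))%MM).+1 by rewrite {1}mE mdegD mdeg1 addn1.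
rewrite {1}mE mderivmDm IHs; last by rewrite -ltnS -dm.
rewrite linearZ /= mderivmU1m mderiv_linear_exp // scalerA dm ffactnSr -subn1 -subnDA addn1.
congr (_ *: _); rewrite natrM [RHS]mulrAC -!mulrA; congr (_ * _); rewrite mulrCA [RHS]mulrC.
congr (_ * _); rewrite mulrC (bigD1 i) //= [in RHS](bigD1 i) //= mulrA -exprS.
congr (_ ^+ _ * _); first by rewrite {2}mE mnmDE mnm1E eqxx addn1.
apply: eq_bigr => j ji; congr (_ ^+ _).
by rewrite {2}mE mnmDE mnm1E eq_sym (negPf ji) addn0.
Qed.

Lemma contract_linear_exp u L j d : u \is j.-homog -> L \is 1.-homog ->
  contract u (L ^+ d) = ((d ^_ j)%:R * u.@[linpt L]) *: L ^+ (d - j).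
Proof.
move=> uj L1; rewrite mevalE /contract mulr_sumr scaler_suml big_seq [RHS]big_seq.
apply: eq_bigr => m um; rewrite mderivm_linear_exp // (dhomog_mf uj um) scalerA.
by rewrite mulrCA.
Qed.

Section CharZero.
Hypothesis k0 : [pchar k] =i pred0.

Lemma natr_neq0 s : (0 < s)%N -> s%:R != 0 :> k.
Proof. by move=> s0; rewrite (proj1 (pcharf0P _) k0) -lt0n. Qed.

Section PowerSum.
Variables (I : finType) (L : I -> {mpoly k[n]}) (d : nat).
Hypothesis L1 : forall b, L b \is 1.-homog.

Lemma contract_power_sum_top u : u \is d.-homog ->
  contract u (\sum_b L b ^+ d) = (d`!%:R * \sum_b u.@[linpt (L b)])%:MP.
Proof.
move=> ud; rewrite linear_sum mulr_sumr raddf_sum /=; apply: eq_bigr => b _.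
by rewrite (contract_linear_exp _ ud) // subnn expr0 ffactnn -mul_mpolyC mulr1.
Qed.

(* Nondegeneracy of the contraction pairing between forms of the same degree. *)
Lemma contract_power_sum_eq0 u s : u \is s.-homog ->
    ((s <= d)%N ->
      forall w, w \is (d - s).-homog -> \sum_b (w * u).@[linpt (L b)] = 0) ->
  contract u (\sum_b L b ^+ d) = 0.
Proof.
move=> us u0; rewrite linear_sum /=.
under eq_bigr => b _ do rewrite (contract_linear_exp _ us) // -scalerA.
have [ds|{}/u0 u0] := ltnP d s.
  by rewrite big1 // => b _; rewrite ffact_small // scale0r.
rewrite -scaler_sumr; set Q := \sum_b _.
suff -> : Q = 0 by rewrite scaler0.
have Qh : Q \is (d - s).-homog.
  apply: rpred_sum => b _; apply: rpredZ.
  by have := dhomogMn (d - s) (L1 b); rewrite mul1n.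
apply/mpolyP => m; rewrite mcoeff0.
case: (eqVneq (mdeg m) (d - s)%N) => [dm|/(dhomog_nemf_coeff Qh)//].
(* Up to a product of factorials, nonzero in characteristic zero, the coefficient of [Q] at [m] is
   the constant term of [mderivm m Q]; the hypothesis applies with [w] the monomial [m]. *)
have := mcoeff_mderivm m Q 0%MM; rewrite addm0.
have -> : mderivm m Q = 0.
  rewrite linear_sum /=.
  under eq_bigr => b _ do rewrite linearZ /= mderivm_linear_exp // dm subnn expr0 ffactnn.
  under eq_bigr => b _ do rewrite scalerA -mevalX mulrCA -mevalM (mulrC u).
  rewrite -scaler_suml; set c := \sum_b _.
  suff -> : c = 0 by rewrite scale0r.
  rewrite /c -mulr_sumr u0 ?mulr0 // dhomogX; exact/eqP.
rewrite mcoeff0 => /esym/eqP; rewrite -mulr_natr mulf_eq0 => /orP[/eqP//|].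
rewrite (negPf (natr_neq0 _)) // prodn_gt0 // => i; by rewrite ffactnn fact_gt0.
Qed.

End PowerSum.

(** Contraction by a form of degree [d] computes [d!] times either sum, and characteristic zero lets
    the factor be cancelled. *)
Lemma power_sum_meval (I J : finType) (L : I -> {mpoly k[n]}) (M : J -> {mpoly k[n]}) d u :
    (forall a, L a \is 1.-homog) -> (forall b, M b \is 1.-homog) ->
    \sum_a L a ^+ d = \sum_b M b ^+ d -> u \is d.-homog ->
  \sum_a u.@[linpt (L a)] = \sum_b u.@[linpt (M b)].
Proof.
move=> L1 M1 LM ud; have := contract_power_sum_top L1 ud.
rewrite LM contract_power_sum_top // => /(congr1 (mcoeff 0)).
by rewrite !mcoeffC eqxx !mulr1 => /mulfI -> //; rewrite natr_neq0 // fact_gt0.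
Qed.

End CharZero.
End Contract.

(** * Waring decompositions *)

Lemma mpoly_neq0_msupp (R : nzRingType) n (p : {mpoly R[n]}) :
  p != 0 -> exists m, m \in msupp p.
Proof.
move=> p0; case E: (msupp p) => [|m l]; first by rewrite (msuppnil0 E) eqxx in p0.
by exists m; exact: mem_head.
Qed.

Section Closed.
Variable k : closedFieldType.

(** Induction on the number of variables: view [p] as a polynomial in the last one, choose [x] where
    one of its coefficients is nonzero, then take a nonroot of the specialised univariate
    polynomial. *)
Lemma mpoly_nonroot n (p : {mpoly k[n]}) : p != 0 -> exists x, p.@[x] != 0.
Proof.
elim: n p => [|n IHn] p /mpoly_neq0_msupp[m pm].
  exists (fun=> 0); rewrite mevalE (bigD1_seq m) ?msupp_uniq //= big_ord0 mulr1.
  by rewrite big1 ?addr0 -?mcoeff_msupp // => l /eqP[]; apply/mnmP => -[].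
pose low (m : 'X_{1..n.+1}) := [multinom m (widen_ord (leqnSn n) i) | i < n].
have low_inj (a b : 'X_{1..n.+1}) : low a = low b -> a ord_max = b ord_max -> a = b.
  move=> /mnmP lab ab; apply/mnmP => i; case: (unliftP ord_max i) => [j ->|->//].
  have := lab j; rewrite !mnmE; suff -> : widen_ord (leqnSn n) j = lift ord_max j by [].
  by apply: val_inj; rewrite /= /bump leqNgt ltn_ord.
(* The coefficient of degree [m ord_max] contains the monomial [low m]: by [low_inj] no other term
   of [p] contributes to it. *)
have [|x xc] := IHn (muni p)`_(m ord_max).
  apply: (contraTneq _ pm) => /(congr1 (mcoeff (low m))).
  rewrite muniE coef_sum raddf_sum mcoeff0 /= (bigD1_seq m pm) ?msupp_uniq //=.
  rewrite big1 ?addr0 => [|l lm].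
    rewrite coefZ coefXn eqxx mulr1 mcoeffZ mcoeffX eqxx mulr1 mcoeff_msupp => ->.
    by rewrite eqxx.
  rewrite coefZ coefXn; case: eqP => [ml|_]; last by rewrite mulr0 mcoeff0.
  rewrite mulr1 mcoeffZ mcoeffX; case: eqP => [/low_inj lml|_]; last by rewrite mulr0.
  by rewrite lml ?eqxx in lm.
pose q := map_poly (meval x) (muni p).
have /closed_nonrootP[z qz] : q != 0.
  by apply: contraNneq xc => q0; rewrite -coef_map -/q q0 coef0.
exists (fun i => oapp x z (unlift ord_max i)); apply: contraNneq qz => pz.
rewrite rootE -{}pz /q muniE mevalE raddf_sum horner_sum /=; apply/eqP.
apply: eq_bigr => l _; rewrite map_polyZ /= map_polyXn hornerZ hornerXn.
rewrite mevalZ -mulrA big_ord_recr /= unlift_none /= mevalX; congr (_ * (_ * _)).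
apply: eq_bigr => i _; rewrite mnmE; set j := widen_ord _ i.
have -> : j = lift ord_max i by apply: val_inj; rewrite /= /bump leqNgt ltn_ord.
by rewrite liftK.
Qed.


End Closed.

Section Waring.
Variables (k : closedFieldType) (k0 : [pchar k] =i pred0) (n d : nat) (d0 : (0 < d)%N).

Definition power_sum (G : {mpoly k[n]}) := exists r, waring_decomp d G r.

Lemma waring_decomp_add (G H : {mpoly k[n]}) r s :
  waring_decomp d G r -> waring_decomp d H s -> waring_decomp d (G + H) (r + s).
Proof.
move=> [L [L1 ->]] [M [M1 ->]].
exists (fun j => match split j with inl a => L a | inr b => M b end); split.
  by move=> j; case: split.
rewrite big_split_ord; congr (_ + _); apply: eq_bigr => j _.
  by rewrite -/(unsplit (inl j)) unsplitK.
by rewrite -/(unsplit (inr j)) unsplitK.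
Qed.

Lemma waring_decomp0 : waring_decomp d (0 : {mpoly k[n]}) 0.
Proof. by exists (fun=> 0); split=> [[]//|]; rewrite big_ord0. Qed.

Lemma power_sum0 : power_sum 0.
Proof. by exists 0%N; exact: waring_decomp0. Qed.

Lemma power_sumD G H : power_sum G -> power_sum H -> power_sum (G + H).
Proof. by move=> [r Gr] [s Hs]; exists (r + s)%N; exact: waring_decomp_add. Qed.

(** A [d]-th root of [c] is absorbed into every linear form. *)
Lemma power_sumZ c G : power_sum G -> power_sum (c *: G).
Proof.
move=> [r [L [L1 ->]]]; have [a ad] : exists a, a ^+ d = c.
  have [a /rootP ra] : exists a, root ('X^d - c%:P) a.
    apply/closed_rootP; by rewrite size_XnsubC // eqSS -lt0n.
  by exists a; apply/eqP; move/eqP: ra; rewrite !hornerE subr_eq0.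
exists r, (fun j => a *: L j); split=> [j|]; first by rewrite rpredZ.
by rewrite scaler_sumr; apply: eq_bigr => j _; rewrite exprZn ad.
Qed.

Lemma power_sum_sum I (r : seq I) (P : pred I) (G : I -> {mpoly k[n]}) :
  (forall i, P i -> power_sum (G i)) -> power_sum (\sum_(i <- r | P i) G i).
Proof. by move=> PG; elim/big_rec: _ => [|i G' /PG]; [exact: power_sum0 | exact: power_sumD]. Qed.

(** Weights reading off the coefficient of [q^l] from the values at [0, ..., s-1]; in characteristic
    zero these nodes are distinct and the Vandermonde matrix is invertible. *)
Lemma exists_interpolation s l : (l < s)%N ->
  exists w : 'I_s -> k, forall j, (j < s)%N -> \sum_(q < s) w q * q%:R ^+ j = (j == l)%:R.
Proof.
move=> ls; pose V := Vandermonde s (\row_(q < s) q%:R : 'rV[k]_s).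
have Vu : V \in unitmx.
  rewrite unitmxE det_Vandermonde unitfE prodf_seq_neq0; apply/allP => i _ /=.
  rewrite prodf_seq_neq0; apply/allP => j _; apply/implyP => ij; rewrite !mxE.
  by rewrite -natrB ?(ltnW ij) // natr_neq0 // subn_gt0.
exists (fun q => invmx V q (Ordinal ls)) => j js.
have /matrixP/(_ (Ordinal js) (Ordinal ls)) := mulmxV Vu.
rewrite !mxE -val_eqE /= => <-; apply: eq_bigr => q _.
by rewrite !mxE mulrC.
Qed.

(* [(L + q M)^(a+1)] is a polynomial in [q] whose linear coefficient is
   [(a+1) L^a M]; interpolating at [q = 0, ..., a+1] extracts it, so factors can
   be absorbed into the power one at a time. *)
Lemma power_sum_prod a (s : seq {mpoly k[n]}) L : (a + size s)%N = d ->
    L \is 1.-homog -> (forall M, M \in s -> M \is 1.-homog) ->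
  power_sum (L ^+ a * \prod_(M <- s) M).
Proof.
elim: s a L => [|M s IHs] a L.
  rewrite addn0 => -> L1 _; rewrite big_nil mulr1.
  by exists 1%N, (fun=> L); rewrite big_ord1.
rewrite /= addnS => ad L1 s1; rewrite big_cons.
have M1 : M \is 1.-homog by apply: s1; rewrite mem_head.
have [|w wP] := @exists_interpolation a.+2 1%N; first by [].
set R := \prod_(M <- s) M.
have -> : L ^+ a * (M * R) =
    (a.+1%:R)^-1 *: \sum_(q < a.+2) w q *: ((L + q%:R *: M) ^+ a.+1 * R).
  under eq_bigr => q _ do rewrite exprDn scalerAl scaler_sumr.
  (* Here [lift ord0 ord0] is the index 1, the term linear in [q]; the weights annihilate all the
     others. *)
  rewrite -mulr_suml exchange_big /= (bigD1 (lift ord0 ord0)) //= [X in _ + X]big1.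
    rewrite addr0 subn1 bin1.
    under eq_bigr => q _ do rewrite expr1 -scalerAr -scaler_nat !scalerA.
    rewrite -scaler_suml; under eq_bigr => q _ do rewrite mulrAC -[q%:R]expr1.
    rewrite -mulr_suml wP // eqxx mul1r -scalerAl scalerA mulVf ?natr_neq0 //.
    by rewrite scale1r mulrA.
  move=> i i1; under eq_bigr => q _ do
    rewrite exprZn -scalerAr -scaler_nat !scalerA mulrAC.
  rewrite -scaler_suml -mulr_suml wP // (_ : _ == _ = false) ?mul0r ?scale0r //.
  by apply: contraNF i1 => /eqP i1; apply/eqP/val_inj.
apply: power_sumZ; apply: power_sum_sum => q _; apply: power_sumZ.
apply: IHs; rewrite ?addSn // ?rpredD ?rpredZ // => N sN.
by apply: s1; rewrite inE sN orbT.
Qed.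

Lemma power_sum_homog G : G \is d.-homog -> power_sum G.
Proof.
move=> Gd; rewrite [G]mpolyE big_seq; apply: power_sum_sum => m mG.
have dm := dhomog_mf Gd mG.
apply: power_sumZ; pose s := flatten [seq nseq (m i) ('X_i : {mpoly k[n]}) | i <- enum 'I_n].
(* A monomial is a product of variables; the empty power [0 ^+ 0 = 1] starts the absorption at
   [a = 0]. *)
have -> : 'X_[m] = 0 ^+ 0 * \prod_(M <- s) M.
  rewrite mul1r mpolyXE_id big_flatten big_map enumT; apply: eq_bigr => i _.
  by rewrite big_nseq iter_mulr_1.
apply: power_sum_prod; rewrite ?dhomog0 //.
  rewrite add0n size_flatten /shape -map_comp -[RHS]dm /= mdegE sumnE big_map enumT.
  by apply: eq_bigr => i _; rewrite /= size_nseq.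
by move=> M /flattenP[t /mapP[i _ ->]] /nseqP[-> _]; rewrite dhomogX /= mdeg1.
Qed.

End Waring.

(** * Blocks of variables and spaces of values *)

Section Substitution.
Variable k : fieldType.

Lemma meval_homog0 n j (p : {mpoly k[n]}) : (0 < j)%N -> p \is j.-homog ->
  p.@[fun=> 0] = 0.
Proof.
move=> j0 pj; rewrite mevalE big_seq big1 // => m mp.
have [i mi] : exists i, m i != 0%N.
  apply: NNPP => /not_ex_all_not m0; move: j0; rewrite -(dhomog_mf pj mp) /= mdegE.
  by rewrite big1 // => i _; apply/eqP/negPn/negP/m0.
by rewrite (bigD1 i) //= expr0n (negPf mi) mul0r mulr0.
Qed.

Lemma comp_mpoly_homog n l j (p : {mpoly k[n]}) (lq : n.-tuple {mpoly k[l]}) :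
    p \is j.-homog -> (forall i, tnth lq i \is 1.-homog) ->
  p \mPo lq \is j.-homog.
Proof.
move=> pj lq1; rewrite comp_mpolyEX big_seq; apply: rpred_sum => m mp.
apply: rpredZ; rewrite comp_mpolyX -(dhomog_mf pj mp) /= mdegE.
elim/big_rec2: _ => [|i s q _ qs]; first exact: dhomog1.
by apply: dhomogM => //; have := dhomogMn (m i) (lq1 i); rewrite mul1n.
Qed.

Lemma linear_formE n (L : {mpoly k[n]}) : L \is 1.-homog ->
  L = \sum_i linpt L i *: 'X_i.
Proof.
move=> L1; apply/mpolyP => m; rewrite raddf_sum /=.
have [/mdeg1P[i /eqP->]|m1] := boolP (mdeg m == 1%N).
  rewrite (bigD1 i) //= mcoeffZ mcoeffXU eqxx mulr1 big1 ?addr0 // => j ji.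
  by rewrite mcoeffZ mcoeffXU (negPf ji) mulr0.
rewrite (dhomog_nemf_coeff L1) // big1 // => i _; rewrite mcoeffZ mcoeffX.
by case: (U_(i)%MM =P m) m1 => [<-|_ _]; rewrite ?mdeg1 // mulr0.
Qed.

End Substitution.

Section Blocks.
Variables (k : fieldType) (m : nat) (s : 'I_m -> nat).
Let N := #|{: {i & 'I_(s i)}}|.

Definition slot i (j : 'I_(s i)) : 'I_N := enum_rank (Tagged (fun l => 'I_(s l)) j).

Definition restr i (x : 'I_N -> k) : 'I_(s i) -> k := fun j => x (slot j).
Arguments restr : clear implicits.

(* The sum has at most one term; it replaces a case analysis on the block of [v],
   which would require a type cast. *)
Definition extend i (y : 'I_(s i) -> k) : 'I_N -> k :=
  fun v => \sum_(j | slot j == v) y j.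

Lemma restr_extend i (y : 'I_(s i) -> k) : restr i (extend y) =1 y.
Proof.
move=> j; rewrite /restr /extend (big_pred1 j) // => l; rewrite /slot.
by rewrite (inj_eq enum_rank_inj) eq_Tagged.
Qed.

Lemma restr_extend_neq i l (y : 'I_(s i) -> k) : l != i -> restr l (extend y) =1 fun=> 0.
Proof.
move=> li j; rewrite /restr /extend big_pred0 // => h.
apply/negP => /eqP/enum_rank_inj/(congr1 tag) /= il.
by rewrite il eqxx in li.
Qed.

Definition incl i (p : {mpoly k[s i]}) : {mpoly k[N]} :=
  p \mPo [tuple 'X_(slot j) | j < s i].

(** As in [extend], the sum has at most one term; variables of the other blocks are sent to 0. *)
Definition proj i (u : {mpoly k[N]}) : {mpoly k[s i]} :=
  u \mPo [tuple \sum_(j < s i | slot j == v) 'X_j | v < N].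

Lemma meval_incl i p x : (@incl i p).@[x] = p.@[restr i x].
Proof.
rewrite comp_mpoly_meval; apply: meval_eq => j.
by rewrite tnth_mktuple mevalXU.
Qed.

Lemma meval_proj i u y : (proj i u).@[y] = u.@[extend y].
Proof.
rewrite comp_mpoly_meval; apply: meval_eq => v.
by rewrite tnth_mktuple raddf_sum; apply: eq_bigr => j _; rewrite /= mevalXU.
Qed.

Lemma incl_homog i j (p : {mpoly k[s i]}) : p \is j.-homog -> incl p \is j.-homog.
Proof.
move=> pj; apply: comp_mpoly_homog => // v.
by rewrite tnth_mktuple dhomogX /= mdeg1.
Qed.

Lemma proj_homog i j u : u \is j.-homog -> proj i u \is j.-homog.
Proof.
move=> uj; apply: comp_mpoly_homog => // v; rewrite tnth_mktuple.
by apply: rpred_sum => l _; rewrite dhomogX /= mdeg1.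
Qed.

Lemma linpt_incl i (L : {mpoly k[s i]}) : L \is 1.-homog ->
  linpt (incl L) =1 extend (linpt L).
Proof.
move=> L1 v; rewrite /linpt {1}(linear_formE L1) /incl.
rewrite (linear_sum (comp_mpoly _)) raddf_sum /=.
rewrite /extend [RHS]big_mkcond; apply: eq_bigr => j _ /=.
rewrite comp_mpolyZ comp_mpolyXU (nth_map j) ?size_tuple //.
rewrite -tnth_nth tnth_ord_tuple mcoeffZ mcoeffXU.
by case: eqP; rewrite ?mulr1 ?mulr0.
Qed.

End Blocks.

Arguments restr {k m s} i x _.

Section MevalInj.
Variable k : closedFieldType.

Lemma meval_inj n (p q : {mpoly k[n]}) : (forall x, p.@[x] = q.@[x]) -> p = q.
Proof.
move=> pq; apply/eqP; rewrite -subr_eq0; apply/negPn/negP => /mpoly_nonroot[x].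
by rewrite mevalB pq subrr eqxx.
Qed.

(** The nonempty open conditions are merged into one polynomial [P] in all the coefficients; a
    product of nonzero polynomials is nonzero, so it has a nonroot. *)
Lemma exists_generic m (s : 'I_m -> nat) (p : forall i, {mpoly k[s i]}) (Q : finType)
    (l : Q -> forall i, 'I_(s i) -> k) :
    (forall i, p i != 0) ->
  exists c : forall i, 'I_(s i) -> k, (forall i, (p i).@[c i] != 0) /\
    forall q, (exists i j, l q i j != 0) -> \sum_i \sum_j c i j * l q i j != 0.
Proof.
move=> p0.
pose f q : {mpoly k[#|{: {i & 'I_(s i)}}|]} := \sum_i \sum_j l q i j *: 'X_(slot j).
pose P := \prod_i incl (p i) * \prod_(q | f q != 0) f q.
have /mpoly_nonroot[x] : P != 0.
  rewrite mulf_neq0 // prodf_seq_neq0; apply/allP => i _; last by apply/implyP.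
  have /mpoly_nonroot[y] := p0 i; rewrite -(meval_eq (p i) (restr_extend y)) -meval_incl.
  by apply: contraNneq => ->; rewrite meval0.
have fE q y : (f q).@[y] = \sum_i \sum_j y (slot j) * l q i j.
  rewrite raddf_sum; apply: eq_bigr => i _; rewrite raddf_sum; apply: eq_bigr => j _.
  by rewrite /= mevalZ mevalXU mulrC.
rewrite mevalM mulf_eq0 negb_or !rmorph_prod => /andP[].
rewrite prodf_seq_neq0 => /allP px; rewrite prodf_seq_neq0 => /allP fx.
exists (fun i => restr i x); split=> [i|q [i [j lq]]].
  by rewrite -meval_incl; apply: px; rewrite mem_index_enum.
rewrite -fE; apply: (implyP (fx q _)); first by rewrite mem_index_enum.
(* Evaluating at the unit vector of [slot j] recovers [l q i j], so [f q] is not zero. *)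
apply: contraNneq lq => fq0; have := fE q (fun v => (v == slot j)%:R).
rewrite fq0 meval0 (bigD1 i) //= (bigD1 j) //= eqxx mul1r !big1 ?addr0 => [->//||].
  move=> i' ii'; rewrite big1 // => j' _; case: eqP => [/enum_rank_inj/(congr1 tag) /= e|_].
    by rewrite e eqxx in ii'.
  by rewrite mul0r.
move=> j' jj'; rewrite /slot (inj_eq enum_rank_inj) eq_Tagged /= (negPf jj').
by rewrite mul0r.
Qed.

End MevalInj.

Section EvalSpace.
Variables (k : fieldType) (N r : nat).
Implicit Types (A : {set 'I_r}) (x : 'I_r -> 'I_N -> k).

(** Entries outside [A] are 0, so that all choices of [A] share one ambient space. *)
Definition evrow A x (u : {mpoly k[N]}) : 'rV[k]_r :=
  \row_a (if a \in A then u.@[x a] else 0).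

Lemma evrow_is_linear A x : linear (evrow A x).
Proof.
move=> c u v; apply/rowP => a; rewrite !mxE.
by case: ifP => _; rewrite ?mulr0 ?addr0 // mevalD mevalZ.
Qed.
HB.instance Definition _ A x :=
  GRing.isLinear.Build k {mpoly k[N]} 'rV[k]_r _ (evrow A x) (evrow_is_linear A x).

Lemma eval_space_exists A x j : exists V : {vspace 'rV[k]_r},
  forall v, (exists2 u, u \is j.-homog & v = evrow A x u) <-> v \in V.
Proof.
apply: vspace_of_pred => [|c v w [u uj ->] [u' uj' ->]].
  by exists 0; rewrite ?rpred0 ?linear0.
by exists (c *: u + u'); rewrite ?linearP // rpredD ?rpredZ.
Qed.

Definition eval_space A x j : {vspace 'rV[k]_r} :=
  proj1_sig (constructive_indefinite_description _ (eval_space_exists A x j)).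

Lemma eval_spaceP A x j v :
  (exists2 u, u \is j.-homog & v = evrow A x u) <-> v \in eval_space A x j.
Proof. by rewrite /eval_space; case: constructive_indefinite_description. Qed.

Lemma dim_coord_space A : (\dim (\sum_(a in A) <[delta_mx 0%R a : 'rV[k]_r]>)%VS <= #|A|)%N.
Proof.
apply: leq_trans (dimv_leq_sum _ _ _) _; rewrite -sum1_card leq_sum // => a _.
by rewrite dim_vline leq_b1.
Qed.

Lemma memv_coord_space A (v : 'rV[k]_r) :
  (forall a, a \notin A -> v 0 a = 0) -> v \in (\sum_(a in A) <[delta_mx 0%R a : 'rV[k]_r]>)%VS.
Proof.
move=> vA; rewrite [v]row_sum_delta (bigID (mem A)) /= [X in _ + X]big1 ?addr0.
  by apply: memv_sumr => a _; rewrite memvZ ?memv_line.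
by move=> a /vA ->; rewrite scale0r.
Qed.

Lemma dim_eval_space A x j : (\dim (eval_space A x j) <= #|A|)%N.
Proof.
apply: leq_trans (dim_coord_space A); apply: dimvS; apply/subvP => _ /eval_spaceP[u _ ->].
by apply: memv_coord_space => a aA; rewrite mxE (negPf aA).
Qed.

(** The values on all points split into the values on [A] and a vector supported off [A]. *)
Lemma dim_eval_spaceT A x j :
  (\dim (eval_space [set: 'I_r] x j) <= \dim (eval_space A x j) + #|~: A|)%N.
Proof.
apply: leq_trans (leq_add (leqnn _) (dim_coord_space (~: A))).
apply: leq_trans (dimv_add_leqif _ _); apply: dimvS; apply/subvP => _ /eval_spaceP[u uj ->].
rewrite -[evrow _ x u](subrKC (evrow A x u)) memv_add //; first by apply/eval_spaceP; exists u.
apply: memv_coord_space => a; rewrite !inE negbK => aA.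
by rewrite !mxE inE aA subrr.
Qed.

End EvalSpace.

(** * The lower bound *)

(** Telescoping along each residue class modulo [e]. Nonzero classes start from [N c <= v c]; class
    0 starts from the bound on [N 0 + N e], whose extra [dl] still fits under [r]. *)
Lemma sum_leq_residues (N v : nat -> nat) e r dl B : (0 < e)%N ->
    (forall j, v j + dl <= r)%N ->
    (forall j, 0 < j -> j < e -> N j <= v j)%N ->
    (forall j, N (j + e) + v j <= v (j + e))%N ->
    (N 0 + N e <= v e + dl)%N ->
  (\sum_(0 <= j < B * e) N j <= e * r)%N.
Proof.
move=> e0 vr Nv Nve N0e.
have -> : (\sum_(0 <= j < B * e) N j = \sum_(0 <= c < e) \sum_(0 <= l < B) N (c + l * e))%N.
  elim: B => [|B IHB].
    by rewrite mul0n big_geq // big1 // => c _; rewrite big_geq.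
  rewrite (@big_cat_nat _ _ _ (B * e)) ?leq_mul2r ?leqnSn ?orbT //= IHB.
  under [RHS]eq_bigr => c _ do rewrite big_nat_recr //=.
  rewrite big_split /= mulSn; congr addn.
  rewrite -[X in index_iota X]add0n big_addn addnK.
  by apply: eq_bigr => c _; rewrite addnC.
suff col c : (c < e)%N -> (\sum_(0 <= l < B) N (c + l * e) <= r)%N.
  rewrite big_seq; apply: (@leq_trans (\sum_(c <- index_iota 0 e | c \in index_iota 0 e) r)).
    by apply: leq_sum => c; rewrite mem_index_iota => /col.
  by rewrite -big_seq sum_nat_const_nat subn0.
case: c => [_|c ce].
  (* Covers the column consisting of [N 0] alone, too short for the induction that starts at
     [N 0 + N e]. *)
  have N0r : (N 0 <= r)%N by apply: leq_trans (vr e); apply: leq_trans N0e; apply: leq_addr.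
  case: B => [|[|B]]; [by rewrite big_geq | by rewrite big_nat1 | ].
  suff H : (\sum_(0 <= l < B.+2) N (0 + l * e) <= v (B.+1 * e) + dl)%N by exact: leq_trans H (vr _).
  elim: B => [|B IHB]; first by rewrite big_nat_recr // big_nat1 /= mul1n mul0n.
  rewrite big_nat_recr //= add0n [(B.+2 * e)%N]mulSn [(e + _)%N]addnC.
  apply: leq_trans (leq_add (Nve (B.+1 * e)%N) (leqnn dl)).
  by rewrite -addnA [(N _ + _)%N]addnC leq_add2r.
case: B => [|B]; first by rewrite big_geq.
suff H : (\sum_(0 <= l < B.+1) N (c.+1 + l * e) <= v (c.+1 + B * e))%N.
  by apply: leq_trans H (leq_trans (leq_addr dl _) (vr _)).
elim: B => [|B IHB]; first by rewrite big_nat1 mul0n addn0 Nv.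
rewrite big_nat_recr //= mulSn [(e + _)%N]addnC addnA.
by apply: leq_trans (Nve _); rewrite addnC leq_add2l.
Qed.

Section LowerBound.
Variables (k : closedFieldType) (k0 : [pchar k] =i pred0).
Variables (m : nat) (n : 'I_m -> nat) (d e : nat) (e0 : (0 < e)%N).
Let s i := (n i).+1.
Let N := #|{: {i & 'I_(s i)}}|.
Variable F : forall i, {mpoly k[s i]}.
Hypothesis Fperp : forall i (g : {mpoly k[s i]}), g \is e.-homog -> perp (F i) g -> g = 0.
Hypothesis de : (e < d)%N.
Variables (b : 'I_m -> nat) (M : forall i, 'I_(b i) -> {mpoly k[s i]}).
Arguments M : clear implicits.
Hypotheses (M1 : forall i j, M i j \is 1.-homog) (FM : forall i, F i = \sum_j M i j ^+ d).
Variables (r : nat) (L : 'I_r -> {mpoly k[N]}).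
Hypotheses (L1 : forall a, L a \is 1.-homog) (FL : \sum_i incl (F i) = \sum_a L a ^+ d).

(** The [L a] and the included [M i j] are two power sum decompositions of the same form, hence give
    the same functional in degree [d]. *)
Lemma apolar_identity (u : {mpoly k[N]}) : u \is d.-homog ->
  \sum_a u.@[linpt (L a)] = \sum_i \sum_j u.@[extend (linpt (M i j))].
Proof.
move=> ud; rewrite sig_big_dep /=.
under [RHS]eq_bigr => p _ do rewrite -(meval_eq u (linpt_incl (M1 (tagged p)))).
apply: (@power_sum_meval _ _ k0 _ _ _
  (fun p : {i & 'I_(b i)} => incl (M (tag p) (tagged p))) d) => //.
  by move=> p; apply: incl_homog; apply: M1.
rewrite -FL; transitivity (\sum_i \sum_j incl (M i j) ^+ d); last exact: sig_big_dep.
by apply: eq_bigr => i _; rewrite FM /incl rmorph_sum; apply: eq_bigr => j _; rewrite rmorphXn.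
Qed.

(* [c] is the restriction of [U] to block [i]; multiplying [U] by [incl w] kills
   its restriction to the other blocks, so the identity above isolates [F i]. *)
Lemma contract_component_eq0 i t (c : {mpoly k[s i]}) (U : {mpoly k[N]}) :
    c \is t.-homog -> U \is t.-homog ->
    (forall y, U.@[extend y] = c.@[y]) ->
    (forall l y w, l != i -> w \is (d - t).-homog ->
      (incl (w : {mpoly k[s i]}) * U).@[@extend k m s l y] = 0) ->
    (forall a, U.@[linpt (L a)] = 0) ->
  contract c (F i) = 0.
Proof.
move=> ct Ut Uc Ul UL; rewrite FM; apply: (contract_power_sum_eq0 k0 (@M1 i) ct) => td w wt.
have /apolar_identity : incl w * U \is d.-homog.
  by rewrite -(subnK td); apply: dhomogM => //; apply: incl_homog.
rewrite big1 => [|a _]; last by rewrite mevalM UL mulr0.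
rewrite (bigD1 i) //= [X in _ = _ + X]big1 ?addr0 => [|l li]; last first.
  by rewrite big1 // => j _; apply: Ul.
move=> /esym UM; rewrite -[RHS]UM; apply: eq_bigr => j _.
by rewrite !mevalM Uc meval_incl (meval_eq _ (restr_extend _)).
Qed.

Variable gs : forall i, seq {mpoly k[s i]}.
Hypothesis gs_e : forall i g, g \in gs i -> g \is e.-homog.
Variable t : forall i, {mpoly k[s i]}.
Hypothesis t_e : forall i, t i \is e.-homog.
Hypothesis t_gs : forall i, t i = 0 -> forall g, g \in gs i -> g = 0.
Let T : {mpoly k[N]} := \sum_i incl (t i).
(** [A] is cut out by [T]; by [gsA] it contains every point where some generator does not vanish. *)
Let A : {set 'I_r} := [set a | T.@[linpt (L a)] != 0].
Hypothesis gsA : forall i g a, g \in gs i -> g.@[restr i (linpt (L a))] != 0 -> a \in A.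
Let J i : {mpoly k[s i]} -> Prop :=
  add_principal (colon (fun g => perp (F i) g) (ideal_gen (gs i))) (t i).
Variable K : forall i j, {vspace dhomog (n i).+1 k j}.
Hypothesis KP : forall i j (u : dhomog (n i).+1 k j), J (val u) <-> u \in K i j.
Let V j := eval_space A (fun a => linpt (L a)) j.
Let q j := (\sum_i (dim (dhomog (n i).+1 k j) - \dim (K i j)))%N.

(** Contraction turns products into compositions, so it is enough to test generators. *)
Lemma colon_perp i (c : {mpoly k[s i]}) :
    (forall g, g \in gs i -> contract (g * c) (F i) = 0) ->
  colon (fun g => perp (F i) g) (ideal_gen (gs i)) c.
Proof.
move=> gc _ [h ->]; apply/eqP; rewrite mulr_sumr contractE.
rewrite (linear_sum (contractl _)) big1 // => j _.
by rewrite -[LHS]/(contract _ (F i)) mulrCA contractM [c * _]mulrC gc ?linear0 ?mem_nth.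
Qed.

Lemma meval_sum_incl_extend j (c : forall i, {mpoly k[s i]}) i y :
    (0 < j)%N -> (forall l, c l \is j.-homog) ->
  (\sum_l incl (c l)).@[extend y] = (c i).@[y].
Proof.
move=> j0 cj; rewrite raddf_sum (bigD1 i) //= big1 ?addr0 => [|l li].
  by rewrite meval_incl (meval_eq _ (restr_extend _)).
by rewrite meval_incl (meval_eq _ (restr_extend_neq _ li)) (meval_homog0 j0).
Qed.

Lemma meval_incl_extend_neq j i l (c : {mpoly k[s i]}) y :
    (0 < j)%N -> c \is j.-homog -> l != i -> (incl c).@[@extend k m s l y] = 0.
Proof.
move=> j0 cj; rewrite eq_sym => li.
by rewrite meval_incl (meval_eq _ (restr_extend_neq _ li)) (meval_homog0 j0).
Qed.

Lemma proj_T i : proj i T = t i.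
Proof. by apply: meval_inj => y; rewrite meval_proj; apply: meval_sum_incl_extend e0 t_e. Qed.

(** A generator [g] of block [i] times the difference of both sides vanishes at every [L a]: on [A]
    by assumption, off [A] because [g] does. Its restriction to block [i] is
    [g * (c i - t i * proj i h)], which therefore kills [F i]. *)
Lemma mem_colon_plus_t j (c : forall i, {mpoly k[s i]}) h :
    (0 < j)%N -> (forall i, c i \is j.-homog) -> T * h \is j.-homog ->
    (forall a, a \in A -> (\sum_i incl (c i)).@[linpt (L a)] = (T * h).@[linpt (L a)]) ->
  forall i, J (c i).
Proof.
move=> j0 cj Thj cT i; exists (c i - t i * proj i h), (proj i h); split; last first.
  by rewrite [t i * _]mulrC subrK.
have pTh : proj i (T * h) = t i * proj i h.
  by rewrite -proj_T; apply: meval_inj => y; rewrite mevalM !meval_proj mevalM.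
apply: colon_perp => g gi; set U := incl g * (\sum_i incl (c i) - T * h).
apply: (@contract_component_eq0 i (e + j) _ U).
- apply: dhomogM; first exact: (gs_e gi).
  (* The degree of [t i * proj i h] is inherited from [T * h] through [proj i]. *)
  by apply: rpredB; [exact: cj | rewrite -pTh; exact: proj_homog].
- apply: dhomogM; first by apply: incl_homog; apply: (gs_e gi).
  by apply: rpredB => //; apply: rpred_sum => l _; apply: incl_homog.
- move=> y; rewrite /U !mevalM !mevalB (meval_sum_incl_extend _ j0 cj) -pTh meval_proj.
  by rewrite meval_incl (meval_eq _ (restr_extend _)).
(* [incl g] has positive degree, so it vanishes on points supported in another block. *)
- by move=> l y w li _; rewrite !mevalM (meval_incl_extend_neq _ e0 (gs_e gi) li) mul0r mulr0.
move=> a; rewrite mevalM mevalB; have [aA|aA] := boolP (a \in A).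
  by rewrite cT // subrr mulr0.
rewrite meval_incl; have [->|ga] := eqVneq g.@[restr i (linpt (L a))] 0; first by rewrite mul0r.
by rewrite (gsA gi ga) in aA.
Qed.

Definition eval_incl (B : {set 'I_r}) j i : {linear dhomog (n i).+1 k j -> 'rV[k]_r} :=
  (evrow B (fun a => restr i (linpt (L a))) \o @mpoly_of_dhomog _ _ j).

Lemma sum_eval_incl B j (u : forall i, dhomog (n i).+1 k j) :
  \sum_i eval_incl B j i (u i) =
    evrow B (fun a => linpt (L a)) (\sum_i incl (val (u i) : {mpoly k[s i]})).
Proof.
rewrite linear_sum; apply: eq_bigr => i _; apply/rowP => a; rewrite !mxE.
by case: ifP => // _; rewrite meval_incl.
Qed.

Lemma eval_incl_mem B j i (u : dhomog (n i).+1 k j) :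
  eval_incl B j i u \in eval_space B (fun a => linpt (L a)) j.
Proof.
apply/eval_spaceP; exists (incl (val u : {mpoly k[s i]})).
  by apply: incl_homog; apply: dhomog_is_dhomog.
by apply/rowP => a; rewrite !mxE; case: ifP => // _; rewrite meval_incl.
Qed.

(* If a form [sum_i c_i] agrees with a multiple of
   [T] on the points of [A], then each [c_i] lies in [K i j].  Hence complements
   of the [K i j] inject into the space of values modulo multiples of [T]. *)
Lemma codim_leq_eval j (W : {vspace 'rV[k]_r}) : (0 < j)%N -> (W <= V j)%VS ->
    (forall v, v \in W -> exists2 h, T * h \is j.-homog &
       v = evrow A (fun a => linpt (L a)) (T * h)) ->
  (q j + \dim W <= \dim (V j))%N.
Proof.
move=> j0 WV WT; apply: (sum_codim_leq (f := eval_incl A j)) => // [i u|u uW i].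
  exact: eval_incl_mem.
apply/KP; move: uW; rewrite sum_eval_incl => /WT[h Thj uh].
apply: (mem_colon_plus_t (c := fun i => val (u i)) j0 _ Thj) => [l|a aA].
  exact: dhomog_is_dhomog.
by move/rowP/(_ a): uh; rewrite !mxE aA.
Qed.

Lemma codim_leq_eval_low j : (0 < j)%N -> (q j <= \dim (V j))%N.
Proof.
move=> j0; have := @codim_leq_eval j 0%VS j0 (sub0v _); rewrite dimv0 addn0; apply.
by move=> v; rewrite memv0 => /eqP->; exists 0; rewrite mulr0 ?linear0 ?rpred0.
Qed.

(** [T] has no zero on [A], so multiplication by [T] embeds [V j] into [V (j + e)]; the image serves
    as [W]. *)
Lemma codim_leq_eval_shift j : (q (j + e) + \dim (V j) <= \dim (V (j + e)))%N.
Proof.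
(* The entries 1 off [A] keep the diagonal matrix invertible; value vectors are 0 there anyway. *)
pose D := \row_a (if a \in A then T.@[linpt (L a)] else 1) : 'rV[k]_r.
pose f := linfun (mulmxr (diag_mx D) : 'rV[k]_r -> 'rV[k]_r).
have fE v a : f v 0 a = v 0 a * D 0 a by rewrite lfunE /= mul_mx_diag mxE.
have f_evrow u : f (evrow A (fun a => linpt (L a)) u) = evrow A (fun a => linpt (L a)) (T * u).
  apply/rowP => a; rewrite fE !mxE; case: ifP => _; last by rewrite mul0r.
  by rewrite mevalM mulrC.
have T_e : T \is e.-homog by apply: rpred_sum => i _; apply: incl_homog.
have -> : \dim (V j) = \dim (f @: V j)%VS.
  rewrite limg_dim_eq //; apply/eqP; rewrite -subv0; apply/subvP => v.
  rewrite memv_cap memv_ker memv0 => /andP[_ /eqP/rowP fv0]; apply/eqP/rowP => a.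
  have := fv0 a; rewrite fE [RHS]mxE => /eqP; rewrite mulf_eq0 mxE.
  rewrite [RHS]mxE => /orP[/eqP//|].
  by case: ifP => [|_]; [rewrite inE => /negPf-> | rewrite oner_eq0].
have fV v : v \in (f @: V j)%VS -> exists2 h, T * h \is (j + e).-homog &
    v = evrow A (fun a => linpt (L a)) (T * h).
  move=> /memv_imgP[_ /eval_spaceP[u uj ->] ->]; exists u; last exact: f_evrow.
  by rewrite addnC; apply: dhomogM.
apply: codim_leq_eval => //; first by rewrite addn_gt0 e0 orbT.
by apply/subvP => v /fV[h Th ->]; apply/eval_spaceP; exists (T * h).
Qed.

Lemma dim_dhomog0 i : dim (dhomog (n i).+1 k 0) = 1%N.
Proof. exact: bin0. Qed.

(* In degree 0 the codimensions may add up to [m], although [T_0] is only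
   one-dimensional; the excess is paid for in degree [e], where each [t i] lies
   in [K i e]. *)
Lemma codim_0e_leq : (q 0 + q e <= \sum_i dim (dhomog (n i).+1 k e))%N.
Proof.
rewrite -big_split; apply: leq_sum => i _ /=.
have [ti|ti] := eqVneq (t i) 0.
  have JT c : J (c : {mpoly k[s i]}).
    exists c, 0; split; last by rewrite mul0r addr0.
    by apply: colon_perp => g /(t_gs ti)->; rewrite mul0r contract0l.
  have KT j : K i j = fullv.
    by apply/vspaceP => u; rewrite memvf; apply/KP.
  by rewrite !KT !dimvf !subnn.
pose te : dhomog (n i).+1 k e := DHomog (t_e i).
have Kt : te \in K i e.
  apply/KP; exists 0, 1; split; last by rewrite mul1r add0r.
  by apply: colon_perp => g _; rewrite mulr0 contract0l.
have K1 : (1 <= \dim (K i e))%N.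
  rewrite (leq_trans _ (dimvS (_ : <[te]> <= _)%VS)) // dim_vline.
  by rewrite -val_eqE /= ti.
have Ke : (\dim (K i e) <= dim (dhomog (n i).+1 k e))%N by rewrite -dimvf dimvS ?subvf.
rewrite -{2}(subnKC Ke) leq_add2r; apply: leq_trans K1.
by rewrite dim_dhomog0 leq_subr.
Qed.

(** Blockwise evaluation on all [r] points is injective in degree [e]: if a sum of forms vanishes at
    every [L a], each component lies in [perp (F i)], hence is zero. *)
Lemma sum_dim_leq_eval :
  (\sum_i dim (dhomog (n i).+1 k e) <= \dim (V e) + #|~: A|)%N.
Proof.
apply: leq_trans (dim_eval_spaceT A _ e).
have := @sum_codim_leq k _ (fun i => dhomog (n i).+1 k e) 'rV[k]_r (eval_incl setT e)
  (fun=> 0%VS) 0%VS (eval_space [set: 'I_r] (fun a => linpt (L a)) e).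
rewrite dimv0 addn0; under eq_bigr => i _ do rewrite dimv0 subn0.
apply=> [i u||u]; [exact: eval_incl_mem | exact: sub0v | rewrite memv0 sum_eval_incl => /eqP u0 i].
rewrite memv0 -val_eqE /=; apply/eqP/Fperp; first exact: dhomog_is_dhomog.
have ue l : (val (u l) : {mpoly k[s l]}) \is e.-homog by apply: dhomog_is_dhomog.
rewrite /perp; apply/eqP.
apply: (@contract_component_eq0 i e _ (\sum_l incl (val (u l) : {mpoly k[s l]}))) => //.
- by apply: rpred_sum => l _; apply: incl_homog.
- by move=> y; apply: (meval_sum_incl_extend _ e0 ue).
(* Since [e < d], [w] has positive degree and [incl w] vanishes on the other blocks. *)
- move=> l y w li wde; rewrite mevalM (meval_incl_extend_neq _ _ wde li) ?mul0r //.
  by rewrite subn_gt0.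
by move=> a; move/rowP/(_ a): u0; rewrite !mxE inE.
Qed.

Lemma sum_codim_leq_rank B : (\sum_(0 <= j < B * e) q j <= e * r)%N.
Proof.
apply: (@sum_leq_residues q (fun j => \dim (V j)) e r #|~: A| B) => //.
- move=> j; rewrite -[r in (_ <= r)%N]card_ord -(cardsC A) leq_add2r; exact: dim_eval_space.
- by move=> j j0 _; apply: codim_leq_eval_low.
- exact: codim_leq_eval_shift.
exact: leq_trans codim_0e_leq sum_dim_leq_eval.
Qed.

End LowerBound.

(** * The theorem *)

Section Degree.
Variable k : fieldType.

(** A nonconstant term would come from a monomial of [G] of degree above [d]. *)
Lemma contract_homog_const n d e (g G : {mpoly k[n]}) : (d <= e)%N ->
    g \is e.-homog -> G \is d.-homog ->
  contract g G = ((contract g G)@_0)%:MP.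
Proof.
move=> de ge Gd; apply/mpolyP => l; rewrite mcoeffC.
have [->|l0] := eqVneq l 0%MM; first by rewrite mulr1.
rewrite mulr0 /contract raddf_sum big_seq big1 // => a ag /=.
rewrite mcoeffZ mcoeff_mderivm (dhomog_nemf_coeff Gd) ?mul0rn ?mulr0 //=.
rewrite mdegD (dhomog_mf ge ag) /= neq_ltn ltnNge; apply/orP; right.
by rewrite -addn1 leq_add // lt0n mdeg_eq0.
Qed.

(* With two variables, the linear map [g |-> contract g G] from degree [e] to
   degree [d - e] cannot be injective when its target has dimension at most 1. *)
Lemma perp_eq0_degree n d e (G : {mpoly k[n.+1]}) : (0 < n)%N -> G \is d.-homog ->
    (forall g, g \is e.-homog -> perp G g -> g = 0) -> (0 < e)%N ->
  (e < d)%N.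
Proof.
move=> n0 Gd Ginj e0; rewrite ltnNge; apply/negP => de.
pose P i : {mpoly k[n.+1]} := 'X_[U_(i) *+ e].
have Ph i : P i \is e.-homog by rewrite dhomogX /= mdegMn mdeg1 mul1n.
have Pc i j : (P i)@_(U_(j) *+ e) = (i == j)%:R.
  rewrite mcoeffX; case: (eqVneq i j) => [->|ij]; first by rewrite eqxx.
  case: eqP => // /mnmP/(_ j); rewrite !mulmnE !mnm1E eqxx (negPf ij) mul0n mul1n.
  by move=> e00; rewrite -e00 in e0.
pose c i := (contract (P i) G)@_0.
have cE i : contract (P i) G = (c i)%:MP by apply: contract_homog_const de (Ph i) Gd.
have Pne i : c i != 0.
  apply/eqP => ci; have := Pc i i; rewrite (Ginj (P i)) ?eqxx ?mcoeff0 //.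
    by move/eqP; rewrite eq_sym oner_eq0.
  by rewrite /perp cE ci.
have ij : ord0 != ord_max :> 'I_n.+1 by rewrite -val_eqE /= eq_sym -lt0n.
(* The combination of two pure powers that cancels the constants is annihilated, hence zero, yet its
   coefficient at the first power is [c ord_max], which is nonzero. *)
have := Pc ord0 ord0; have := congr1 (mcoeff (U_(ord0) *+ e))
  (Ginj (c ord_max *: P ord0 + (- c ord0) *: P ord_max) _ _).
rewrite mcoeffD !mcoeffZ !Pc eqxx eq_sym (negPf ij) mulr1 mulr0 addr0 mcoeff0.
move=> H; case/negP: (Pne ord_max); apply/eqP/H.
  by rewrite rpredD ?rpredZ.
rewrite /perp contractDl contractZl.
by rewrite !cE -!mul_mpolyC -!mpolyCM -mpolyCD mulNr mulrC subrr.
Qed.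

End Degree.

Section RankTheory.
Variables (k : closedFieldType) (k0 : [pchar k] =i pred0).

Lemma waring_decomp_sum n d (I : Type) (s : seq I) (G : I -> {mpoly k[n]}) r :
    (forall i, waring_decomp d (G i) (r i)) ->
  waring_decomp d (\sum_(i <- s) G i) (\sum_(i <- s) r i)%N.
Proof.
move=> Gr; elim/big_rec2: _ => [|i r' G' _ Gr']; [exact: waring_decomp0 | exact: waring_decomp_add].
Qed.

Lemma waring_decomp_incl m (s : 'I_m -> nat) d i (G : {mpoly k[s i]}) r :
  waring_decomp d G r -> waring_decomp d (incl G) r.
Proof.
move=> [L [L1 ->]]; exists (fun j => incl (L j)); split=> [j|]; first exact: incl_homog.
by rewrite /incl rmorph_sum; apply: eq_bigr => j _; rewrite rmorphXn.
Qed.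

Lemma waring_decomp_rk n d (G : {mpoly k[n]}) : (0 < d)%N -> G \is d.-homog ->
  waring_decomp d G (rk d G).
Proof. by move=> d0 /(power_sum_homog k0 d0)[r /cminP[]]. Qed.

Lemma rk_leq n d (G : {mpoly k[n]}) r : waring_decomp d G r -> (rk d G <= r)%N.
Proof. by case/cminP. Qed.

Lemma rk0 n d : rk d (0 : {mpoly k[n]}) = 0%N.
Proof.
by apply/eqP; rewrite -leqn0; apply/rk_leq/waring_decomp0.
Qed.

Lemma colon_plus_vspace n j (G t : {mpoly k[n.+1]}) (I : {mpoly k[n.+1]} -> Prop) :
  exists U : {vspace dhomog n.+1 k j}, forall u : dhomog n.+1 k j,
    add_principal (colon (fun g => perp G g) I) t (val u) <-> u \in U.
Proof.
apply: vspace_of_pred => [|c u v [a [b [Ja ua]]] [a' [b' [Ja' va]]]].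
  exists 0, 0; split; last by rewrite mul0r addr0.
  by move=> h _; rewrite mul0r /perp contract0l.
exists (c *: a + a'), (c *: b + b'); split; last first.
  by rewrite -[LHS]/(c *: val u + val v) ua va scalerDr mulrDl -scalerAl addrACA.
move=> h Ih; rewrite /perp mulrDl -scalerAl contractDl.
by rewrite (eqP (Ja h Ih)) (eqP (Ja' h Ih)) scaler0 addr0.
Qed.

Lemma HF_vspace n j (J : {mpoly k[n.+1]} -> Prop) (U : {vspace dhomog n.+1 k j}) :
    (forall u : dhomog n.+1 k j, J (val u) <-> u \in U) ->
  HF J j = (dim (dhomog n.+1 k j) - \dim U)%N.
Proof.
move=> JU; rewrite /HF (dimsp_vspace JU) -dimvf.
by congr (_ - _)%N; apply: dimsp_vspace => u; rewrite memvf.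
Qed.

(** Each condition asks that a polynomial in the coefficients not vanish. For [t i] to be nonzero, a
    single coefficient is tested: the one at the leading monomial of the first nonzero generator. *)
Lemma generic_forms m (s : 'I_m -> nat) (gs : forall i, seq {mpoly k[s i]})
    (p : forall i, {mpoly k[size (gs i)]}) (Q : finType) (x : Q -> forall i, 'I_(s i) -> k) :
    (forall i, p i != 0) ->
  exists c : forall i, 'I_(size (gs i)) -> k, let t i := \sum_j c i j *: (gs i)`_j in
    [/\ forall i, (p i).@[c i] != 0,
        forall i, t i = 0 -> forall g, g \in gs i -> g = 0 &
        forall q i g, g \in gs i -> g.@[x q i] != 0 -> \sum_i (t i).@[x q i] != 0].
Proof.
move=> p0.
(* If all generators are zero, [find] runs off the end and the default 0 is taken; the value matters
   only when a nonzero generator exists. *)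
pose lm i := mlead (gs i)`_(find (fun g => g != 0) (gs i)).
pose l (q : Q + 'I_m) i (j : 'I_(size (gs i))) : k :=
  match q with
  | inl a => ((gs i)`_j).@[x a i]
  | inr i0 => if i == i0 then ((gs i)`_j)@_(lm i) else 0
  end.
have [c [pc lc]] := exists_generic l p0; exists c; split=> //.
  move=> i ti g gi; apply/eqP/negPn/negP => g0.
  have gs0 : has (fun g => g != 0) (gs i) by apply/hasP; exists g.
  have := lc (inr i); rewrite (bigD1 i) //= eqxx [X in _ + X]big1 ?addr0 =>
    [|i' /negPf ii']; last first.
    by rewrite big1 // => j _; rewrite ii' mulr0.
  have -> : \sum_j c i j * ((gs i)`_j)@_(lm i) = (\sum_j c i j *: (gs i)`_j)@_(lm i).
    by rewrite raddf_sum; apply: eq_bigr => j _; rewrite /= mcoeffZ.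
  rewrite ti mcoeff0 eqxx => H; suff /H : exists i0 j, l (inr i) i0 j != 0 by [].
  have lt := gs0; rewrite has_find in lt; exists i, (Ordinal lt).
  rewrite /l eqxx -mcoeff_msupp; apply: mlead_supp.
  exact: (nth_find 0 gs0).
move=> a i g gi ga; have := lc (inl a).
have -> : \sum_i \sum_j c i j * l (inl a) i j = \sum_i (\sum_j c i j *: (gs i)`_j).@[x a i].
  apply: eq_bigr => i' _; rewrite raddf_sum; apply: eq_bigr => j _.
  by rewrite /= mevalZ.
apply; exists i; have ig := gi; rewrite -index_mem in ig; exists (Ordinal ig).
by rewrite /l /= nth_index.
Qed.

End RankTheory.

Theorem theorem5p5 (k : closedFieldType) (hk : [pchar k] =i pred0)
  (m : nat) (n : 'I_m -> nat) (hn : forall i, (1 <= n i)%N)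
  (d e : nat) (he : (1 <= e)%N)
  (Fs : forall i : 'I_m, {mpoly k[(n i).+1]})
  (hFd : forall i, Fs i \is d.-homog)
  (hcomp : forall i, e_computable d e (Fs i))
  (hperp : forall i (g : {mpoly k[(n i).+1]}),
      g \is e.-homog -> perp (Fs i) g -> g = 0) :
  rk d (\sum_(i < m) emb (Fs i)) = (\sum_(i < m) rk d (Fs i))%N.
Proof.
(* Without blocks both sides are 0; deriving [e < d] takes a block. *)
have [m0|m_gt0] := posnP m.
  by move: n hn Fs hFd hcomp hperp; rewrite m0 => *; rewrite !big_ord0 rk0.
have de : (e < d)%N.
  by have i0 := Ordinal m_gt0; apply: perp_eq0_degree (hn i0) (hFd i0) (@hperp i0) he.
have d0 : (0 < d)%N by apply: leq_ltn_trans de.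
have Fdec i := waring_decomp_rk hk d0 (hFd i).
pose s i := (n i).+1.
have Fsum : waring_decomp d (\sum_i @incl k m s i (Fs i)) (\sum_i rk d (Fs i))%N.
  by apply: waring_decomp_sum => i; apply: (@waring_decomp_incl k m s); apply: Fdec.
(* Concatenated decompositions give the upper bound; [incl] unfolds to [emb]. *)
have := @rk_leq k _ d _ _ Fsum; set r := rk _ _ => r_le.
have [L [L1 FL]] : waring_decomp d (\sum_i @incl k m s i (Fs i)) r by case: (cminP Fsum).
suff r_ge : (\sum_i rk d (Fs i) <= r)%N by apply/eqP; rewrite eqn_leq r_le.
pose M i := proj1_sig (constructive_indefinite_description _ (Fdec i)).
have [M1 FM] : (forall i j, M i j \is 1.-homog) /\ (forall i, Fs i = \sum_j M i j ^+ d).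
  by split=> i; rewrite /M; case: constructive_indefinite_description => /= ? [].
pose gs i := proj1_sig (constructive_indefinite_description _ (hcomp i)).
have gsP i := proj2_sig (constructive_indefinite_description _ (hcomp i)).
have gs_e i : forall g, g \in gs i -> g \is e.-homog by case: (gsP i).
pose p i := proj1_sig (constructive_indefinite_description _ (proj2 (gsP i))).
have pP i := proj2_sig (constructive_indefinite_description _ (proj2 (gsP i))).
(* The [t i] are chosen general with respect to the block components of a minimal decomposition of
   the sum. *)
have [|c] := @generic_forms k m s gs p _ (fun a i => restr i (linpt (L a))).
  by move=> i; case: (pP i).
set t := fun i => _; move=> [pc t_gs gsA].
have t_e i : t i \is e.-homog.
  by apply: rpred_sum => j _; apply/rpredZ/gs_e/mem_nth.
pose K i j := proj1_sig (constructive_indefinite_description _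
  (@colon_plus_vspace k (n i) j (Fs i) (t i) (ideal_gen (gs i)))).
have KP i j := proj2_sig (constructive_indefinite_description _
  (@colon_plus_vspace k (n i) j (Fs i) (t i) (ideal_gen (gs i)))).
have HFt i := proj2 (pP i) (c i) (pc i).
pose j0 i := proj1_sig (constructive_indefinite_description _ (HFt i)).
have j0P i := proj2_sig (constructive_indefinite_description _ (HFt i)).
pose q i j := (dim (dhomog (n i).+1 k j) - \dim (K i j))%N.
have HFq i j : HF (add_principal (colon (fun g => perp (Fs i) g) (ideal_gen (gs i))) (t i)) j
   = q i j by apply: HF_vspace; apply: KP.
(* [B * e] bounds every [j0 i], so all Hilbert sums can be cut there, and every residue class modulo
   [e] gets exactly [B] terms. *)
pose B := (\sum_i j0 i)%N.
have qsum i : (\sum_(0 <= j < B * e) q i j = e * rk d (Fs i))%N.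
  have [q0 <-] := j0P i.
  have jB : (j0 i <= B * e)%N.
    by apply: leq_trans (leq_pmulr _ he); rewrite /B (bigD1 i) //= leq_addr.
  rewrite (@big_cat_nat _ _ _ (j0 i)) //= [X in (_ + X)%N]big_nat.
  rewrite [X in (_ + X)%N]big1 ?addn0 => [|j /andP[jj _]].
    by rewrite big_mkord; apply: eq_bigr => j _; rewrite -HFq.
  by rewrite -HFq; apply: q0.
(* Multiplying by [e] turns the ranks into Hilbert sums, which are then regrouped by degree. *)
rewrite -(leq_pmul2l he) big_distrr /=.
under eq_bigr => i _ do rewrite -qsum.
rewrite exchange_big /=.
have gA i g a : g \in gs i -> g.@[restr i (linpt (L a))] != 0 ->
    a \in [set a | (\sum_i @incl k m s i (t i)).@[linpt (L a)] != 0].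
  move=> gi /(gsA _ _ _ gi); rewrite inE raddf_sum.
  by under [in X in _ -> X]eq_bigr => l _ do rewrite /= meval_incl.
exact: (@sum_codim_leq_rank k hk m n d e he Fs hperp de _ M M1 FM r L L1 FL
  gs gs_e t t_e t_gs gA K KP).
Qed.
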